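(* Suppose that $L$ is irreducible, that $\rho>\lambda_0(1-\gamma)$, and that $g>\lambda_1$. Then the unique solution $\widehat K^k$ of the closed loop equation $K'(t)=(L+A-F)K(t)$, $t\ge0$, $K(0)=k\in\mathbb{R}^n$, is $$\widehat K^k(t)=\frac{\langle k,b^0\rangle}{\alpha}e^{gt}y+\sum_{m=1}^{n-1}\left(\langle k,b^m\rangle-\frac{\beta_m\langle k,b^0\rangle}{\alpha(\lambda_m-g)}\right)e^{\lambda_mt}\,b^m,\qquad t\ge0.$$ Therefore, for any $k\in\mathbb{R}^n_+$, the detrended path $\widehat K^k_g(t)=e^{-gt}\widehat K^k(t)$ satisfies $$\widehat K^k_g(t)\longrightarrow\overline K^k_g:=\frac{\langle k,b^0\rangle}{\alpha}\,y\qquad\text{as }t\to+\infty.$$ If, moreover, $w_{ij}\ge f_{ij}$ for all $i\neq j$, then $\overline K^k_g\in\mathbb{R}^n_+$ for all $k\in\mathbb{R}^n_+$.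
   Context: $\mathbb{R}^n_+$ is the set of vectors in $\mathbb{R}^n$ with all components $\ge 0$. Here $n\ge2$, $\rho>0$, $\gamma>0$ with $\gamma\ne1$, $p_1,\dots,p_n>0$, $A=\mathrm{diag}(A_1,\dots,A_n)$ with $A_i>0$. $W=(w_{ij})$ is a symmetric matrix of graph weights with $w_{ij}\ge0$, $w_{ii}=0$, and $L=(\ell_{ij})$ is given by $\ell_{ij}=w_{ij}$ for $i\neq j$ and $\ell_{ii}=-\sum_{j\ne i}w_{ij}$. $L$ irreducible means that the graph on $\{1,\dots,n\}$ with edges $\{i,j\}$ whenever $w_{ij}>0$ is connected. $\lambda_0\ge\lambda_1\ge\dots\ge\lambda_{n-1}$ are the eigenvalues of the symmetric matrix $L+A$ with an orthonormal basis of eigenvectors $b^0,\dots,b^{n-1}$, where $b^0$ has strictly positive components. Put $\Phi(b^0)=\sum_{i=1}^np_i^{1/\gamma}(b^0_i)^{(\gamma-1)/\gamma}$, $\alpha=\frac{\gamma\Phi(b^0)}{\rho-\lambda_0(1-\gamma)}$, $g=\frac{\lambda_0-\rho}{\gamma}$, let $F$ be the $n\times n$ matrix with entries $f_{ij}=\frac1\alpha\left(\frac{p_i}{b^0_i}\right)^{1/\gamma}b^0_j$, and let $\beta_m=\sum_{i=1}^n(p_i/b^0_i)^{1/\gamma}b^m_i$ for $m=1,\dots,n-1$, and $y=\alpha b^0+\sum_{m=1}^{n-1}\frac{\beta_m}{\lambda_m-g}b^m$. *)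

(* Defs.v *)
From HB Require Import structures.
From mathcomp Require Import all_boot all_order all_algebra.
From mathcomp Require Import all_classical all_reals all_analysis.
Set Implicit Arguments.
Unset Strict Implicit.
Unset Printing Implicit Defensive.
Import Order.TTheory GRing.Theory Num.Theory.
Import numFieldNormedType.Exports.
Local Open Scope classical_set_scope.
Local Open Scope ring_scope.

Section LinearAlgebra.
Context {R : realType} {n : nat}.
Implicit Types (u v : 'cV[R]_n) (S W : 'M[R]_n).

Definition nonneg_orthant : set 'cV[R]_n := [set k | forall i, 0 <= k i 0].

Definition dot u v : R := \sum_i u i 0 * v i 0.

Definition is_weight_matrix W : Prop :=
  [/\ forall i j, W i j = W j i,
      forall i j, 0 <= W i j
    & forall i, W i i = 0].

Definition Lmx W : 'M[R]_n :=
  \matrix_(i, j) (if i == j then - \sum_(k | k != i) W i k else W i j).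

(* Irreducibility of [Lmx W], as connectedness of the weighted graph. *)
Definition Lmx_irreducible W : Prop :=
  forall i j, connect [rel i j | 0 < W i j] i j.

(* Since the family [b] has as many members as the dimension, orthonormality
   makes it a basis, so [lam] lists all eigenvalues of [S] with
   multiplicity. *)
Definition is_ordered_eigenbasis S (lam : 'I_n -> R) (b : 'I_n -> 'cV[R]_n) :
    Prop :=
  [/\ forall i j : 'I_n, (i <= j)%N -> lam j <= lam i,
      forall m, S *m b m = lam m *: b m
    & forall i j, dot (b i) (b j) = (i == j)%:R].

(* [K] solves K' = M K on [0, +oo[ with K(0) = k; the difference quotient only
   uses times s >= 0, so the derivative is two-sided for t > 0 and
   right-sided at t = 0. Values of [K] at negative times are irrelevant. *)
Definition solves_linear_ode (M : 'M[R]_n) (k : 'cV[R]_n) (K : R -> 'cV[R]_n) :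
    Prop :=
  K 0 = k /\
  forall t : R, 0 <= t ->
    (s - t)^-1 *: (K s - K t) @[s --> within [set s | 0 <= s] t^']
      --> M *m K t.

End LinearAlgebra.

Section Model.
Context {R : realType} {n : nat}.
(* [l0] stands for the top eigenvalue, [b0] for its positive eigenvector. *)
Variables (rho gamma : R) (p : 'I_n.+1 -> R).

Definition Phi (b0 : 'cV[R]_n.+1) : R :=
  \sum_i p i `^ (1 / gamma) * b0 i 0 `^ ((gamma - 1) / gamma).

Definition alpha (l0 : R) (b0 : 'cV[R]_n.+1) : R := gamma * Phi b0 / (rho - l0 * (1 - gamma)).

Definition growth (l0 : R) : R := (l0 - rho) / gamma.

Definition Fmx (l0 : R) (b0 : 'cV[R]_n.+1) : 'M[R]_n.+1 :=
  \matrix_(i, j) ((alpha l0 b0)^-1 * (p i / b0 i 0) `^ (1 / gamma) * b0 j 0).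

Variables (lam : 'I_n.+1 -> R) (b : 'I_n.+1 -> 'cV[R]_n.+1).
Let l0 := lam ord0.
Let b0 := b ord0.
Let g := growth l0.

Definition beta (m : 'I_n.+1) : R :=
  \sum_i (p i / b0 i 0) `^ (1 / gamma) * b m i 0.

Definition yvec : 'cV[R]_n.+1 :=
  alpha l0 b0 *: b0 + \sum_(m | m != ord0) (beta m / (lam m - g)) *: b m.

Definition Khat (k : 'cV[R]_n.+1) (t : R) : 'cV[R]_n.+1 :=
  (dot k b0 / alpha l0 b0 * expR (g * t)) *: yvec
  + \sum_(m | m != ord0)
      ((dot k (b m) - beta m * dot k b0 / (alpha l0 b0 * (lam m - g)))
         * expR (lam m * t)) *: b m.

Definition Kbar (k : 'cV[R]_n.+1) : 'cV[R]_n.+1 :=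
  (dot k b0 / alpha l0 b0) *: yvec.

End Model.

(* Main.v *)
(* Let q_i = (p_i/b0_i)^(1/gamma). Then F k = (<k,b0>/alpha) q, so N = L+A-F is a
   rank-one perturbation of L+A, and <q,b0> = Phi(b0) gives
   lambda_0 - <q,b0>/alpha = g. Hence N is diagonalized by the right eigenvectors
   y/alpha, b^1, ..., b^(n-1) and the left eigenvectors b0,
   b^m - beta_m/(alpha(lambda_m - g)) b0, with eigenvalues g, lambda_1, ...,
   lambda_(n-1). Pairing a solution with the left eigenvectors reduces the equation
   to scalar ones, and the limit follows from lambda_m < g. When w_ij >= f_ij, N has
   nonnegative off-diagonal entries, so N|y| >= g|y|; pairing with b0 > 0 forces
   equality, and as g is a simple eigenvalue, y is a positive multiple of |y|. *)
Require Import Defs.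
From HB Require Import structures.
From mathcomp Require Import all_boot all_order all_algebra.
From mathcomp Require Import all_classical all_reals all_analysis.
From mathcomp Require Import ring.
Set Implicit Arguments.
Unset Strict Implicit.
Unset Printing Implicit Defensive.
Import Order.TTheory GRing.Theory Num.Theory.
Import numFieldNormedType.Exports.
Local Open Scope classical_set_scope.
Local Open Scope ring_scope.

(** * Uniqueness for the scalar equation x' = mu x on the half-line *)

Section ScalarEquation.
Context {R : realType}.

Lemma cvg_dnbhs_shift (T : Type) (f : R -> T) (t : R) (G : set_system T) :
  f s @[s --> t^'] --> G <-> f (h + t) @[h --> (0 : R)^'] --> G.
Proof.
have E A : (\forall s \near t^', A (f s)) = (\forall h \near (0 : R)^', A (f (h + t))).
  rewrite /dnbhs !near_withinE [LHS](near_shift 0 t) /=.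
  apply: eq_near => h /=; rewrite subr0. by rewrite -subr_eq0 addrK.
split=> fG A GA; have := fG A GA.
  by rewrite -[nbhs _ A]/(\forall s \near t^', A (f s)) E.
by rewrite -[nbhs _ A]/(\forall h \near 0^', A (f (h + t))) -E.
Qed.

(** [solves_linear_ode] lets s tend to t, while [is_derive] lets an increment h tend to 0; the
    change of variable s = h + t links the two. *)
Lemma is_derive_quotientP (V : normedModType R) (f : R -> V) (t : R) (l : V) :
  is_derive t 1 f l <-> (s - t)^-1 *: (f s - f t) @[s --> t^'] --> l.
Proof.
rewrite cvg_dnbhs_shift.
have -> : (fun h : R => (h + t - t)^-1 *: (f (h + t) - f t))
    = (fun h : R => h^-1 *: ((f \o shift t) (h *: 1) - f t)).
  by apply/funext => h /=; rewrite addrK -[h *: 1]/(h * 1) mulr1.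
split=> [[df <-]|fl]; first exact: df.
by split; [apply/cvg_ex; exists l | exact: cvg_lim fl].
Qed.

(** The product exp(-mu s) x(s) is continuous on [0, t] with zero derivative inside, so the mean
    value theorem makes its values at 0 and t equal. Continuity at 0 needs its own argument, since
    only the right-sided quotient is controlled there. *)
Lemma scalar_ode_unique (mu : R) (x : R -> R) :
  (forall t : R, 0 <= t ->
    (s - t)^-1 * (x s - x t) @[s --> within [set s | 0 <= s] t^']
      --> mu * x t) ->
  forall t : R, 0 <= t -> x t = x 0 * expR (mu * t).
Proof.
move=> dx t; rewrite le_eqVlt => /predU1P[<-|t0].
  by rewrite mulr0 expR0 mulr1.
have derx (s : R) : 0 < s -> is_derive s 1 x (mu * x s).
  (* Near s > 0 the restriction to nonnegative times is vacuous, so the limit is two-sided. *)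
  move=> s0; apply/is_derive_quotientP; apply: cvg_trans (dx s (ltW s0)).
  apply: cvg_app => A hA.
  have pos : \forall u \near s^', 0 < u by apply: cvg_within; exact: lt_nbhsr.
  have hA' : \forall u \near s^', 0 <= u -> A u := hA.
  by apply: filterS2 pos hA' => u /ltW u0; exact.
have cx0 : x s @[s --> (0 : R)^'+] --> x 0.
  have right0 : (0 : R)^'+ `=>` within [set s | 0 <= s] (0 : R)^'.
    move=> A hA; have hA' : \forall s \near (0 : R), s != 0 -> 0 <= s -> A s := hA.
    by apply: filterS hA' => s hs s0; apply: hs; rewrite ?gt_eqF ?ltW.
  have id0 : (s - 0) @[s --> (0 : R)^'+] --> (0 - 0 : R).
    apply: cvg_at_right_filter.
    apply: (@cvgB _ _ _ _ _ id (cst 0)); [exact: cvg_id | exact: cvg_cst].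
  have dx0 : (s - 0)^-1 * (x s - x 0) @[s --> (0 : R)^'+] --> mu * x 0.
    by apply: cvg_trans (dx 0 (lexx 0)); exact: cvg_app.
  (* Right continuity at 0: x(s) is x(0) plus s times a quotient that converges. *)
  have : x 0 + (s - 0) * ((s - 0)^-1 * (x s - x 0)) @[s --> (0 : R)^'+]
      --> x 0 + (0 - 0) * (mu * x 0).
    by apply: cvgD; [exact: cvg_cst | exact: cvgM].
  rewrite subrr mul0r addr0 => h; apply: cvg_trans h.
  apply: near_eq_cvg; near=> s => /=.
  have s0 : 0 < s by near: s; exact: nbhs_right_gt.
  by rewrite subr0 mulrA divff ?gt_eqF// mul1r addrC subrK.
pose f (s : R) := expR (- mu * s) * x s.
have derf (s : R) : s \in `]0, t[ -> is_derive s 1 f 0.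
  rewrite in_itv/= => /andP[s0 _]; have := derx _ s0 => ?.
  apply: is_derive_eq; rewrite /GRing.scale/=; ring.
have [|c _] := MVT t0 derf.
  have expc : continuous (fun s : R => expR (- mu * s)).
    by move=> s /=; apply: continuous_comp; [exact: mulrl_continuous | exact: continuous_expR].
  apply/continuous_within_itvP => //; split.
  - move=> s /derf ?; apply: differentiable_continuous.
    by apply/derivable1_diffP.
  - by apply: cvgM => //; apply: cvg_at_right_filter; exact: expc.
  - apply: cvg_at_left_filter; apply: cvgM; first exact: expc.
    have ? := derx _ t0.
    by apply: differentiable_continuous; apply/derivable1_diffP.
rewrite mul0r => /eqP; rewrite subr_eq0 /f mulr0 expR0 mul1r => /eqP <-.
by rewrite mulrAC mulNr -expRD addNr expR0 mul1r.
Unshelve. all: by end_near. Qed.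

End ScalarEquation.

(** * Scalar product and expansion in an orthonormal family *)

Section DotProduct.
Context {R : realType} {n : nat}.
Implicit Types u v w : 'cV[R]_n.

Lemma dotDl u v w : dot (u + v) w = dot u w + dot v w.
Proof. by rewrite /dot -big_split; apply: eq_bigr => i _; rewrite mxE mulrDl. Qed.

Lemma dotZl (x : R) u w : dot (x *: u) w = x * dot u w.
Proof. by rewrite /dot mulr_sumr; apply: eq_bigr => i _; rewrite mxE mulrA. Qed.

Lemma dotC u w : dot u w = dot w u.
Proof. by apply: eq_bigr => i _; rewrite mulrC. Qed.

Lemma dotBl u v w : dot (u - v) w = dot u w - dot v w.
Proof. by rewrite dotDl -[- v]scaleN1r dotZl mulN1r. Qed.

Lemma dotBr u v w : dot w (u - v) = dot w u - dot w v.
Proof. by rewrite dotC dotBl !(dotC w). Qed.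

Lemma dotZr (x : R) u w : dot w (x *: u) = x * dot w u.
Proof. by rewrite dotC dotZl dotC. Qed.

Lemma dot_suml (I : finType) (P : pred I) (F : I -> 'cV[R]_n) w :
  dot (\sum_(i | P i) F i) w = \sum_(i | P i) dot (F i) w.
Proof.
elim/big_rec2: _ => [|i x y _ <-]; last by rewrite dotDl.
by rewrite /dot big1 // => i _; rewrite mxE mul0r.
Qed.

Lemma cvg_dot (T : Type) (F : set_system T) {FF : Filter F}
    (K : T -> 'cV[R]_n) (l w : 'cV[R]_n) :
  K t @[t --> F] --> l -> dot (K t) w @[t --> F] --> dot l w.
Proof.
move=> Kl; rewrite /dot; apply: cvg_big => [|i _]; first exact: add_continuous.
apply: cvgMr_tmp.
by apply: (cvg_comp K (fun M : 'cV[R]_n => M i 0) Kl); exact: coord_continuous.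
Qed.

(** With the b_m as columns of a square matrix B, orthonormality is B^T B = 1; hence B B^T = 1,
    which applied to k is the expansion. *)
Lemma orthonormal_expansion (b : 'I_n -> 'cV[R]_n) :
  (forall i j, dot (b i) (b j) = (i == j)%:R) ->
  forall k, k = \sum_m dot k (b m) *: b m.
Proof.
move=> ob k; pose B : 'M[R]_n := \matrix_(i, m) b m i 0.
have BB : B *m B^T = 1%:M.
  apply: mulmx1C; apply/matrixP => i j; rewrite !mxE -(ob i j).
  by apply: eq_bigr => l _; rewrite !mxE.
rewrite -[LHS]mul1mx -BB -mulmxA; apply/colP => i.
rewrite summxE !mxE; apply: eq_bigr => m _; rewrite !mxE mulrC.
by congr (_ * _); apply: eq_bigr => j _; rewrite !mxE mulrC.
Qed.

End DotProduct.

(** * Linear equations with a diagonalizable matrix *)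

Section DiagonalizedEquation.
Context {R : realType} {n : nat}.
Variables (N : 'M[R]_n) (mu : 'I_n -> R) (v c : 'I_n -> 'cV[R]_n).
Hypothesis expansion : forall k, k = \sum_m dot k (c m) *: v m.
Hypothesis right_eigen : forall m, N *m v m = mu m *: v m.
Hypothesis left_eigen : forall m k, dot (N *m k) (c m) = mu m * dot k (c m).

(** This is exp(t N) k, written with the right eigenvectors v and the dual left eigenvectors c. *)
Definition spectral_flow (k : 'cV[R]_n) (t : R) : 'cV[R]_n :=
  \sum_m (dot k (c m) * expR (mu m * t)) *: v m.

Lemma spectral_flow_solves k : solves_linear_ode N k (spectral_flow k).
Proof.
split; first by rewrite /spectral_flow; under eq_bigr do
  rewrite mulr0 expR0 mulr1; rewrite -expansion.
move=> t _; apply: cvg_within_filter.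
have -> : N *m spectral_flow k t =
    \sum_m (dot k (c m) * (mu m * expR (mu m * t))) *: v m.
  rewrite /spectral_flow mulmx_sumr; apply: eq_bigr => m _.
  by rewrite -scalemxAr right_eigen scalerA; congr (_ *: _); ring.
have -> : (fun s : R => (s - t)^-1 *: (spectral_flow k s - spectral_flow k t)) =
    (fun s : R => \sum_m (dot k (c m) *
       ((s - t)^-1 *: (expR (mu m * s) - expR (mu m * t)))) *: v m).
  apply/funext => s; rewrite /spectral_flow -sumrB scaler_sumr.
  apply: eq_bigr => m _.
  by rewrite -scalerBl scalerA; congr (_ *: _); rewrite /GRing.scale/=; ring.
apply: cvg_big => [|m _]; first exact: add_continuous.
apply: cvgZr_tmp; apply: cvgMl_tmp; apply/is_derive_quotientP.
have ? : is_derive t 1 (fun s : R => mu m * s) (mu m).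
  by apply: is_derive_eq; rewrite /GRing.scale/= mulr1.
by apply: is_derive_eq; rewrite mulrC.
Qed.

Lemma spectral_flow_unique k K :
  solves_linear_ode N k K -> forall t : R, 0 <= t -> K t = spectral_flow k t.
Proof.
move=> [K0 dK] t t0; rewrite [LHS]expansion; apply: eq_bigr => m _.
congr (_ *: _); rewrite -K0.
apply: (scalar_ode_unique (x := fun s => dot (K s) (c m))) t0 => s s0.
rewrite -left_eigen.
under eq_cvg do rewrite -dotBl -dotZl.
by apply: cvg_dot; exact: dK.
Qed.

Lemma spectral_flow_detrended (m0 : 'I_n) k :
  (forall m, m != m0 -> mu m < mu m0) ->
  expR (- mu m0 * t) *: spectral_flow k t @[t --> +oo] --> dot k (c m0) *: v m0.
Proof.
move=> dom.
have -> : (fun t : R => expR (- mu m0 * t) *: spectral_flow k t) =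
    (fun t : R => \sum_m (dot k (c m) * expR ((mu m - mu m0) * t)) *: v m).
  apply/funext => t; rewrite /spectral_flow scaler_sumr.
  apply: eq_bigr => m _; rewrite scalerA; congr (_ *: _).
  by rewrite mulrCA -expRD; congr (_ * expR _); ring.
have -> : dot k (c m0) *: v m0 =
    \sum_m (dot k (c m) * (m == m0)%:R) *: v m.
  rewrite (bigD1 m0)//= eqxx mulr1 big1 ?addr0// => m /negPf ->.
  by rewrite mulr0 scale0r.
apply: cvg_big => [|m _]; first exact: add_continuous.
apply: cvgZr_tmp; apply: cvgMl_tmp.
have [->|/dom mm0] := eqVneq m m0.
  by rewrite subrr; under eq_cvg do rewrite mul0r expR0; exact: cvg_cst.
have -> : (fun t : R => expR ((mu m - mu m0) * t)) =
    (fun t : R => expR (- ((mu m0 - mu m) * t))).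
  by apply/funext => t; congr expR; ring.
apply: (cvg_comp (fun t : R => (mu m0 - mu m) * t) (fun t => expR (- t))).
  by apply: gt0_cvgMry; [rewrite subr_gt0 | exact: cvg_id].
exact: cvgr_expR.
Qed.

End DiagonalizedEquation.

(** * Matrices with nonnegative off-diagonal entries *)

Section MetzlerEigenvector.
Context {R : realType} {n : nat}.

(* With g an eigenvalue of N having a positive left eigenvector u, |y| satisfies
   N |y| >= g |y| entrywise, and pairing with u forces equality. *)
Lemma metzler_abs_eigenvector (N : 'M[R]_n) (g : R) (y u : 'cV[R]_n) :
  (forall i j, i != j -> 0 <= N i j) ->
  N *m y = g *: y -> (forall i, 0 < u i 0) ->
  (forall k, dot (N *m k) u = g * dot k u) ->
  N *m map_mx Num.norm y = g *: map_mx Num.norm y.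
Proof.
move=> Nge Ny u0 Nu; set z := map_mx _ y.
pose d : 'cV[R]_n := N *m z - g *: z.
have d0 i : 0 <= d i 0.
  rewrite !mxE subr_ge0.
  have : (N *m y) i 0 = g * y i 0 by rewrite Ny mxE.
  rewrite mxE (bigD1 i)//= [leRHS](bigD1 i)//= mxE => yi.
  rewrite -lerBlDl -mulrBl.
  (* The diagonal entry may have any sign, so it is moved to the left before taking absolute values;
     only nonnegative coefficients remain on the right. *)
  have {}yi : (g - N i i) * y i 0 = \sum_(j | j != i) N i j * y j 0.
    by rewrite mulrBl -yi addrAC subrr add0r.
  apply: (@le_trans _ _ `|(g - N i i) * y i 0|).
    by rewrite normrM ler_wpM2r ?ler_norm.
  rewrite yi; apply: le_trans (ler_norm_sum _ _ _) _.
  apply: ler_sum => j ji; rewrite normrM mxE ger0_norm// Nge// eq_sym //.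
have : dot d u = 0 by rewrite /d dotBl dotZl Nu subrr.
move=> /psumr_eq0P dz; apply/eqP; rewrite -subr_eq0; apply/eqP/colP => i.
have /eqP := dz (fun i _ => mulr_ge0 (d0 i) (ltW (u0 i))) i isT.
by rewrite mulf_eq0 (gt_eqF (u0 i)) orbF => /eqP ->; rewrite mxE.
Qed.

End MetzlerEigenvector.

(** * Spectral decomposition of a rank-one perturbation *)

Section RankOnePerturbation.
Context {R : realType} {n : nat}.
Variables (M N : 'M[R]_n.+1) (lam : 'I_n.+1 -> R) (b : 'I_n.+1 -> 'cV[R]_n.+1).
Variables (q : 'cV[R]_n.+1) (al g : R).
Hypothesis M_eigen : forall m, M *m b m = lam m *: b m.
Hypothesis b_orthonormal : forall i j, dot (b i) (b j) = (i == j)%:R.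
Hypothesis N_def : forall k, N *m k = M *m k - (dot k (b ord0) / al) *: q.
Hypothesis al_neq0 : al != 0.
Hypothesis g_def : g = lam ord0 - dot q (b ord0) / al.
Hypothesis g_gap : forall m, m != ord0 -> lam m != g.

(** Solution of N y = g y with <y, b_0> = al: then N y = M y - q, and the b_m coordinate c of y must
    satisfy lam_m c - <q, b_m> = g c. *)
Definition perturbed_top : 'cV[R]_n.+1 :=
  al *: b ord0 + \sum_(m | m != ord0) (dot q (b m) / (lam m - g)) *: b m.

Definition perturbed_eigenvalue (m : 'I_n.+1) : R :=
  if m == ord0 then g else lam m.

Definition perturbed_right (m : 'I_n.+1) : 'cV[R]_n.+1 :=
  if m == ord0 then al^-1 *: perturbed_top else b m.

(** Since N^T b_m = lam_m b_m - (<q, b_m> / al) b_0 and N^T b_0 = g b_0, the multiple of b_0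
    subtracted here is the one making the result an eigenvector of N^T for lam_m. The factor 1 / al
    in [perturbed_right] makes the two families dual. *)
Definition perturbed_left (m : 'I_n.+1) : 'cV[R]_n.+1 :=
  if m == ord0 then b ord0
  else b m - (dot q (b m) / (al * (lam m - g))) *: b ord0.

(** Stands in for the symmetry of M, which is read off from its orthonormal eigenbasis. *)
Lemma dot_mulM k m : dot (M *m k) (b m) = lam m * dot k (b m).
Proof.
rewrite {1}(orthonormal_expansion b_orthonormal k) mulmx_sumr dot_suml.
rewrite (bigD1 m)//= big1 => [|j jm].
  by rewrite -scalemxAr M_eigen !dotZl b_orthonormal eqxx mulr1 addr0 mulrC.
by rewrite -scalemxAr M_eigen !dotZl b_orthonormal (negPf jm) !mulr0.
Qed.

Lemma perturbed_expansion k :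
  k = \sum_m dot k (perturbed_left m) *: perturbed_right m.
Proof.
rewrite {1}(orthonormal_expansion b_orthonormal k) (bigD1 ord0)//= [RHS](bigD1 ord0)//=.
rewrite /perturbed_left /perturbed_right eqxx scalerA /perturbed_top.
rewrite scalerDr scalerA divfK// -addrA; congr (_ + _).
rewrite scaler_sumr -big_split/=; apply: eq_bigr => m m0.
rewrite (negPf m0) scalerA -scalerDl dotBr dotZr; congr (_ *: _).
have ? : lam m - g != 0 by rewrite subr_eq0 g_gap.
by field; apply/andP.
Qed.

Lemma perturbed_left_eigen m k :
  dot (N *m k) (perturbed_left m) =
  perturbed_eigenvalue m * dot k (perturbed_left m).
Proof.
rewrite N_def /perturbed_left /perturbed_eigenvalue; case: eqVneq => [_|m0].
  by rewrite dotBl dot_mulM dotZl g_def; ring.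
rewrite !(dotBl, dotBr, dotZr, dotZl) !dot_mulM.
have ? : lam m - g != 0 by rewrite subr_eq0 g_gap.
have -> : lam ord0 = g + dot q (b ord0) / al by rewrite g_def subrK.
by field; apply/andP.
Qed.

Lemma dot_perturbed_top : dot perturbed_top (b ord0) = al.
Proof.
rewrite /perturbed_top dotDl dotZl b_orthonormal eqxx mulr1 dot_suml big1 ?addr0//.
by move=> m m0; rewrite dotZl b_orthonormal (negPf m0) mulr0.
Qed.

Lemma perturbed_top_eigen : N *m perturbed_top = g *: perturbed_top.
Proof.
rewrite N_def dot_perturbed_top divff// scale1r.
rewrite [q in LHS](orthonormal_expansion b_orthonormal) (bigD1 ord0)//=.
rewrite /perturbed_top mulmxDr mulmx_sumr -scalemxAr M_eigen.
rewrite opprD addrACA -sumrB scalerDr scaler_sumr; congr (_ + _).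
  by rewrite !scalerA -scalerBl g_def; congr (_ *: _); field.
apply: eq_bigr => m m0; rewrite -scalemxAr M_eigen !scalerA -scalerBl.
have ? : lam m - g != 0 by rewrite subr_eq0 g_gap.
by congr (_ *: _); field.
Qed.

Lemma perturbed_right_eigen m :
  N *m perturbed_right m = perturbed_eigenvalue m *: perturbed_right m.
Proof.
rewrite /perturbed_right /perturbed_eigenvalue; case: eqVneq => [_|m0].
  by rewrite -scalemxAr perturbed_top_eigen !scalerA mulrC.
by rewrite N_def b_orthonormal (negPf m0) mul0r scale0r subr0 M_eigen.
Qed.

Lemma spectral_flow_perturbedE k t :
  spectral_flow perturbed_eigenvalue perturbed_right perturbed_left k t =
  (dot k (b ord0) / al * expR (g * t)) *: perturbed_top
  + \sum_(m | m != ord0)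
      ((dot k (b m) - dot q (b m) * dot k (b ord0) / (al * (lam m - g)))
         * expR (lam m * t)) *: b m.
Proof.
rewrite /spectral_flow (bigD1 ord0)//=; congr (_ + _).
  rewrite /perturbed_eigenvalue /perturbed_right /perturbed_left eqxx.
  by rewrite scalerA mulrAC.
apply: eq_bigr => m m0.
rewrite /perturbed_eigenvalue /perturbed_right /perturbed_left (negPf m0).
by rewrite dotBr dotZr [_ / _ * _]mulrAC.
Qed.

(* The g-eigenspace of N is the line spanned by [perturbed_top]; as it contains
   |perturbed_top|, that vector has constant sign. *)
Lemma perturbed_top_ge0 :
  (forall i, 0 < b ord0 i 0) -> 0 < al ->
  (forall i j, i != j -> 0 <= N i j) -> nonneg_orthant perturbed_top.
Proof.
move=> b00 al0 N0 i; set z := map_mx Num.norm perturbed_top.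
have Nb0 k : dot (N *m k) (b ord0) = g * dot k (b ord0).
  exact: (perturbed_left_eigen ord0 k).
have Nz : N *m z = g *: z.
  exact: metzler_abs_eigenvector N0 perturbed_top_eigen b00 Nb0.
have zE : z = (dot z (b ord0) / al) *: perturbed_top.
  rewrite [LHS]perturbed_expansion (bigD1 ord0)//= big1 ?addr0.
    by rewrite /perturbed_left /perturbed_right eqxx scalerA.
  (* Pairing N z = g z with the m-th left eigenvector gives (g - lam_m) <z, c_m> = 0, so this
     coordinate of z vanishes. *)
  move=> m m0; have := perturbed_left_eigen m z.
  rewrite Nz dotZl /perturbed_eigenvalue (negPf m0) => /eqP.
  rewrite -subr_eq0 -mulrBl mulf_eq0 subr_eq0 eq_sym (negPf (g_gap m0)) /=.
  by move=> /eqP ->; rewrite scale0r.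
(* The factor relating z to [perturbed_top] is thus at least 1, in particular positive, and z >= 0
   transfers its sign. *)
have alz : al <= dot z (b ord0).
  rewrite -[leLHS]dot_perturbed_top; apply: ler_sum => j _.
  by rewrite [z j 0]mxE; apply: ler_wpM2r; [exact: ltW | exact: ler_norm].
have : 0 <= z i 0 by rewrite [z i 0]mxE.
rewrite zE [X in 0 <= X]mxE pmulr_rge0// divr_gt0//; exact: lt_le_trans alz.
Qed.

End RankOnePerturbation.

(** * The constants of the economic model *)

Section ClosedLoop.
Context {R : realType} {n : nat}.
Variables (rho gamma : R) (p : 'I_n.+1 -> R).
Hypothesis gamma_gt0 : 0 < gamma.
Hypothesis p_gt0 : forall i, 0 < p i.

Definition consumption_vec (b0 : 'cV[R]_n.+1) : 'cV[R]_n.+1 :=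
  \col_i (p i / b0 i 0) `^ (1 / gamma).

Lemma betaE b m : beta gamma p b m = dot (consumption_vec (b ord0)) (b m).
Proof. by apply: eq_bigr => i _; rewrite mxE. Qed.

Lemma mul_Fmx l0 b0 k :
  Fmx rho gamma p l0 b0 *m k =
  (dot k b0 / alpha rho gamma p l0 b0) *: consumption_vec b0.
Proof.
apply/colP => i; rewrite !mxE mulr_suml mulr_suml; apply: eq_bigr => j _.
by rewrite !mxE; ring.
Qed.

Lemma dot_consumption_vec (b0 : 'cV[R]_n.+1) : (forall i, 0 < b0 i 0) ->
  dot (consumption_vec b0) b0 = Phi gamma p b0.
Proof.
move=> b00; apply: eq_bigr => i _; rewrite mxE.
have bi := b00 i; have pi := p_gt0 i.
(* For positive bases each power is exp of a multiple of ln, which reduces the claim to the exponent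
   identity 1 - 1/gamma = (gamma - 1)/gamma. *)
rewrite -[X in _ * X]lnK ?posrE// /powR !gt_eqF ?divr_gt0// -!expRD.
rewrite ln_div ?posrE//; congr expR; field; exact: lt0r_neq0.
Qed.

Lemma alpha_gt0 (l0 : R) (b0 : 'cV[R]_n.+1) : (forall i, 0 < b0 i 0) -> l0 * (1 - gamma) < rho ->
  0 < alpha rho gamma p l0 b0.
Proof.
move=> b00 hrho; rewrite /alpha divr_gt0 ?subr_gt0// mulr_gt0//.
have pos i : 0 < p i `^ (1 / gamma) * b0 i 0 `^ ((gamma - 1) / gamma).
  by rewrite mulr_gt0// powR_gt0.
rewrite /Phi (bigD1 ord0)//= ltr_pwDl// sumr_ge0// => i _; exact: ltW.
Qed.

(** By the choice of [alpha], Phi / alpha = (rho - l0 (1 - gamma)) / gamma, and subtracting this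
    from l0 leaves (l0 - rho) / gamma. *)
Lemma growthE (l0 : R) (b0 : 'cV[R]_n.+1) : (forall i, 0 < b0 i 0) -> l0 * (1 - gamma) < rho ->
  growth rho gamma l0 = l0 - Phi gamma p b0 / alpha rho gamma p l0 b0.
Proof.
move=> b00 hrho; have := alpha_gt0 b00 hrho; rewrite /alpha /growth => al0.
have d0 : rho - l0 * (1 - gamma) != 0 by rewrite subr_eq0 gt_eqF.
have P0 : Phi gamma p b0 != 0.
  by apply: contraTneq al0 => ->; rewrite mulr0 mul0r ltxx.
have g0 := lt0r_neq0 gamma_gt0.
by field; rewrite d0 P0 g0.
Qed.

End ClosedLoop.

Theorem theorem5p12 (R : realType) (n : nat) (rho gamma : R)
    (p : 'I_n.+2 -> R) (a : 'rV[R]_n.+2) (W : 'M[R]_n.+2)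
    (lam : 'I_n.+2 -> R) (b : 'I_n.+2 -> 'cV[R]_n.+2) :
  let M := Lmx W + diag_mx a in
  let l0 := lam ord0 in
  let l1 := lam (lift ord0 ord0) in
  let b0 := b ord0 in
  let g := growth rho gamma l0 in
  let F := Fmx rho gamma p l0 b0 in
  0 < rho -> 0 < gamma -> gamma != 1 ->
  (forall i, 0 < p i) ->
  (forall i, 0 < a ord0 i) ->
  is_weight_matrix W ->
  is_ordered_eigenbasis M lam b ->
  (forall i, 0 < b0 i ord0) ->
  Lmx_irreducible W ->
  l0 * (1 - gamma) < rho ->
  l1 < g ->
  [/\ forall k : 'cV[R]_n.+2,
        solves_linear_ode (M - F) k (Khat rho gamma p lam b k) /\
        (forall K : R -> 'cV[R]_n.+2, solves_linear_ode (M - F) k K ->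
          forall t : R, 0 <= t -> K t = Khat rho gamma p lam b k t),
      forall k : 'cV[R]_n.+2, nonneg_orthant k ->
        forall K : R -> 'cV[R]_n.+2, solves_linear_ode (M - F) k K ->
          expR (- g * t) *: K t @[t --> +oo] --> Kbar rho gamma p lam b k
    & (forall i j, i != j -> F i j <= W i j) ->
        forall k : 'cV[R]_n.+2, nonneg_orthant k ->
          nonneg_orthant (Kbar rho gamma p lam b k)].
Proof.
move=> M l0 l1 b0 g F _ gamma0 _ p0 _ Wwt [lam_mono Mb ob] b00 _ hrho hgap.
pose q := consumption_vec gamma p b0; pose al := alpha rho gamma p l0 b0.
have al0 : 0 < al by exact: alpha_gt0.
have alN0 := lt0r_neq0 al0.
have gE : g = l0 - dot q b0 / al by rewrite dot_consumption_vec// -growthE.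
have lamg m : m != ord0 -> lam m < g.
  (* A nonzero index is at least 1, so lam_m <= l1 < g. *)
  move=> m0; apply: le_lt_trans hgap; apply: lam_mono.
  by case: m m0 => [[]].
have gap m (m0 : m != ord0) : lam m != g by rewrite lt_eqF ?lamg.
have NE k : (M - F) *m k = M *m k - (dot k b0 / al) *: q.
  by rewrite mulmxBl mul_Fmx.
have yE : yvec rho gamma p lam b = perturbed_top lam b q al g.
  by rewrite /yvec; under eq_bigr do rewrite betaE.
have KhatE k : Khat rho gamma p lam b k =
    spectral_flow (perturbed_eigenvalue lam g) (perturbed_right lam b q al g)
      (perturbed_left lam b q al g) k.
  apply/funext => t; rewrite spectral_flow_perturbedE /Khat yE.
  by under eq_bigr do rewrite betaE.
have expansion := perturbed_expansion q ob alN0 gap.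
have left_eigen := perturbed_left_eigen Mb ob NE alN0 gE gap.
have flow_solves := spectral_flow_solves expansion
  (perturbed_right_eigen Mb ob NE alN0 gE gap).
have flow_unique := spectral_flow_unique expansion left_eigen.
split.
- move=> k; rewrite KhatE; split; first exact: flow_solves.
  by move=> K; exact: flow_unique.
- move=> k _ K Ksol.
  have := @spectral_flow_detrended _ _ (perturbed_eigenvalue lam g)
    (perturbed_right lam b q al g) (perturbed_left lam b q al g) ord0 k.
  rewrite /Kbar yE /perturbed_right /perturbed_left eqxx scalerA.
  move=> h; apply: cvg_trans (h _); last first.
    by move=> m m0; rewrite /perturbed_eigenvalue eqxx (negPf m0); exact: lamg.
  (* K agrees with the flow only for t >= 0, which holds eventually as t tends to infinity. *)
  apply: near_eq_cvg; near=> t => /=.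
  by rewrite (flow_unique _ _ Ksol).
- move=> FW k k0 i; rewrite /Kbar yE mxE mulr_ge0//.
    apply: divr_ge0; last exact: ltW.
    by apply: sumr_ge0 => j _; rewrite mulr_ge0// ltW.
  apply: (perturbed_top_ge0 Mb ob NE alN0 gE gap) => // {}i j ij.
  (* Off the diagonal, M has the entries of W, so those of M - F are W i j - F i j. *)
  rewrite !mxE (negPf ij) mulr0n addr0 subr_ge0; have := FW i j ij.
  by rewrite mxE.
Unshelve. all: by end_near. Qed.
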